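(* Let $\mathbb U$ and $\mathbb V$ be Banach spaces and let $B:\mathbb U\to\mathbb V^*$ be a linear, continuous and bounded-below operator (i.e. there is $\gamma_B>0$ with $\|Bw\|_{\mathbb V^*}\ge\gamma_B\|w\|_{\mathbb U}$ for all $w$). Assume that $\mathbb V$ and $\mathbb V^*$ are reflexive and strictly convex. Let $f\in\mathbb V^*$, let $\mathbb U_n\subset\mathbb U$ and $\mathbb V_m\subset\mathbb V$ be finite-dimensional subspaces, and let $I_m:\mathbb V_m\to\mathbb V$ be the natural injection with adjoint (restriction) $I_m^*:\mathbb V^*\to(\mathbb V_m)^*$. Then, for $(r_m,u_n)\in\mathbb V_m\times\mathbb U_n$, the following statements are equivalent: (i) $(r_m,u_n)$ is a solution of the discrete mixed problem $$\langle J_{\mathbb V}(r_m),v_m\rangle_{\mathbb V^*,\mathbb V}+\langle Bu_n,v_m\rangle_{\mathbb V^*,\mathbb V}=\langle f,v_m\rangle_{\mathbb V^*,\mathbb V}\quad\forall v_m\in\mathbb V_m,\qquad\langle Bw_n,r_m\rangle_{\mathbb V^*,\mathbb V}=0\quad\forall w_n\in\mathbb U_n .$$ (ii) $u_n$ is a solution of the inexact nonlinear Petrov--Galerkin discretization $$\bigl\langle\nu_n,\,I_mJ_{\mathbb V_m}^{-1}\bigl(I_m^*(f-Bu_n)\bigr)\bigr\rangle_{\mathbb V^*,\mathbb V}=0\qquad\forall\nu_n\in B\mathbb U_n,$$ and $r_m=J_{\mathbb V_m}^{-1}\bigl(I_m^*(f-Bu_n)\bigr)$. (iii) $u_n$ is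 a minimizer of the discrete residual minimization problem $\min_{w_n\in\mathbb U_n}\|I_m^*(f-Bw_n)\|_{(\mathbb V_m)^*}$, and $r_m=J_{\mathbb V_m}^{-1}\bigl(I_m^*(f-Bu_n)\bigr)$. (iv) $u_n$ is the Lagrange multiplier of the discrete constrained minimization problem $$\min_{v_m\in\mathbb V_m\cap(B\mathbb U_n)^\perp}\Bigl\{\tfrac12\|v_m\|_{\mathbb V}^2-\langle f,v_m\rangle_{\mathbb V^*,\mathbb V}\Bigr\},$$ while $r_m$ is its minimizer.
   Context: All spaces are real. For a normed space $\mathbb Y$, the duality mapping is $\mathcal J_{\mathbb Y}(y)=\{y^*\in\mathbb Y^*:\langle y^*,y\rangle=\|y\|_{\mathbb Y}^2=\|y^*\|_{\mathbb Y^*}^2\}$. A normed space is strictly convex if $\|\theta y_1+(1-\theta)y_2\|<1$ whenever $y_1\ne y_2$, $\|y_1\|=\|y_2\|=1$, $\theta\in(0,1)$. If $\mathbb Y$ and $\mathbb Y^*$ are strictly convex and reflexive Banach spaces, then $\mathcal J_{\mathbb Y}(y)=\{J_{\mathbb Y}(y)\}$ is single-valued and $J_{\mathbb Y}:\mathbb Y\to\mathbb Y^*$ is a bijection (known fact); this applies to $\mathbb V$ and to $\mathbb V_m$ (with the norm of $\mathbb V$), giving $J_{\mathbb V}$ and $J_{\mathbb V_m}:\mathbb V_m\to(\mathbb V_m)^*$. The dual norm is $\|g\|_{(\mathbb V_m)^*}=\sup_{v_m\in\mathbb V_m\setminus\{0\}}\langle g,v_m\rangle/\|v_m\|_{\mathbb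 V}$. $(B\mathbb U_n)^\perp:=\{v\in\mathbb V:\langle Bw_n,v\rangle=0\ \forall w_n\in\mathbb U_n\}$. In (iv), ''Lagrange multiplier and minimizer'' means that $(r_m,u_n)$ is a saddle point of $\mathcal L(v_m,w_n):=\tfrac12\|v_m\|_{\mathbb V}^2-\langle f,v_m\rangle+\langle Bw_n,v_m\rangle$ on $\mathbb V_m\times\mathbb U_n$: $\mathcal L(r_m,w_n)\le\mathcal L(r_m,u_n)\le\mathcal L(v_m,u_n)$ for all $(v_m,w_n)\in\mathbb V_m\times\mathbb U_n$. *)

(* Defs.v *)
(* MathComp-Analysis, over an arbitrary [R : realType]. *)
From HB Require Import structures.
From mathcomp Require Import all_boot all_order all_algebra.
From mathcomp Require Import boolp classical_sets functions reals topology.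
From mathcomp Require Import normedtype.

Set Implicit Arguments.
Unset Strict Implicit.
Unset Printing Implicit Defensive.

Import Order.TTheory GRing.Theory Num.Theory.
Import numFieldNormedType.Exports.

Local Open Scope classical_set_scope.
Local Open Scope ring_scope.

Section Dual.
Context {R : realType} (X : normedModType R).

Definition bounded_functional : {pred X -> R^o} :=
  [pred g | `[< linear g /\ continuous g >]].

Lemma bounded_functionalP (g : X -> R^o) :
  reflect (linear g /\ continuous g) (g \in bounded_functional).
Proof. exact: asboolP. Qed.

Lemma bounded_functional_submod_closed : submod_closed bounded_functional.
Proof.
split=> [|a g h].
  apply/bounded_functionalP; split=> [a x y|]; last exact: cst_continuous.
  by rewrite -[0 : X -> R^o]/(cst 0)/= scaler0 addr0.
move=> /bounded_functionalP[gl gc] /bounded_functionalP[hl hc].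
apply/bounded_functionalP; split=> [b x y|x].
  rewrite -[LHS]/(a *: g (b *: x + y) + h (b *: x + y)) gl hl.
  rewrite -[(a *: g + h) x]/(a *: g x + h x) -[(a *: g + h) y]/(a *: g y + h y).
  by rewrite !scalerDr !scalerA (mulrC a) addrACA.
by apply: cvgD; [apply: cvgZr; exact: gc | exact: hc].
Qed.

HB.instance Definition _ := GRing.isSubmodClosed.Build R (X -> R^o)
  bounded_functional bounded_functional_submod_closed.

Record dual := Dual {
  dual_fun :> X -> R^o;
  dual_funP : dual_fun \in bounded_functional }.

HB.instance Definition _ := [isSub for dual_fun].
HB.instance Definition _ := [Choice of dual by <:].
HB.instance Definition _ := [SubChoice_isSubLmodule of dual by <:].

Lemma dual_linear (g : dual) : linear g.
Proof. by case/bounded_functionalP: (dual_funP g). Qed.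

HB.instance Definition _ (g : dual) :=
  GRing.isLinear.Build R X R^o _ g (dual_linear g).

Lemma dual_continuous (g : dual) : continuous g.
Proof. by case/bounded_functionalP: (dual_funP g). Qed.

(* For X = {0} the set is empty and [sup set0 = 0]. *)
Definition dual_norm (g : dual) : R :=
  sup [set g x / `|x| | x in [set x : X | x != 0]].

Let dual_quot_le (g : dual) : exists2 M : R, 0 <= M &
  forall x, `|g x| <= M * `|x|.
Proof.
have /linear_bounded_continuous/linear_boundedP := @dual_continuous g.
case=> M [Mr MP]; exists (`|M| + 1); first by rewrite addr_ge0.
by apply: MP; rewrite (le_lt_trans (real_ler_norm Mr))// ltrDl.
Qed.

Let dual_has_ubound (g : dual) :
  has_ubound [set g x / `|x| | x in [set x : X | x != 0]].
Proof.
have [M M0 gM] := dual_quot_le g; exists M => _ [x /= x0 <-].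
by rewrite ler_pdivrMr ?normr_gt0// (le_trans (ler_norm _)).
Qed.

Lemma dual_norm_ge0 (g : dual) : 0 <= dual_norm g.
Proof.
have [[x x0]|ex] := pselect (exists x : X, x != 0); last first.
  rewrite /dual_norm (_ : mkset _ = set0) ?image_set0 ?sup0//.
  by rewrite -subset0 => x x0; apply: ex; exists x.
have up y : y != 0 -> g y / `|y| <= dual_norm g.
  by move=> y0; apply: (ub_le_sup (dual_has_ubound g)); exists y.
have [gx|gx] := leP 0 (g x).
  by rewrite (le_trans _ (up x x0))// divr_ge0.
by rewrite (le_trans _ (up (- x) _)) ?oppr_eq0// linearN normrN divr_ge0// oppr_ge0 ltW.
Qed.

Lemma dual_norm_le (g : dual) x : `|g x| <= dual_norm g * `|x|.
Proof.
have [->|x0] := eqVneq x 0; first by rewrite linear0 !normr0 mulr0.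
have le y : y != 0 -> g y <= dual_norm g * `|y|.
  move=> y0; rewrite -ler_pdivrMr ?normr_gt0//.
  by apply: (ub_le_sup (dual_has_ubound g)); exists y.
rewrite ler_norml le// andbT lerNl -linearN (le_trans (le _ _)) ?oppr_eq0//.
by rewrite normrN.
Qed.

Lemma dual_norm_min (g : dual) (M : R) : 0 <= M ->
  (forall x, `|g x| <= M * `|x|) -> dual_norm g <= M.
Proof.
move=> M0 gM.
have [[x x0]|ex] := pselect (exists x : X, x != 0); last first.
  rewrite /dual_norm (_ : mkset _ = set0) ?image_set0 ?sup0//.
  by rewrite -subset0 => x x0; apply: ex; exists x.
apply: ge_sup; first by exists (g x / `|x|), x.
by move=> _ [y /= y0 <-]; rewrite ler_pdivrMr ?normr_gt0// (le_trans (ler_norm _)).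
Qed.

Let dual_normD (g h : dual) : dual_norm (g + h) <= dual_norm g + dual_norm h.
Proof.
apply: dual_norm_min => [|x]; first by rewrite addr_ge0 ?dual_norm_ge0.
by rewrite (le_trans (ler_normD _ _))// mulrDl lerD ?dual_norm_le.
Qed.

Let dual_normZ_le (a : R) (g : dual) : dual_norm (a *: g) <= `|a| * dual_norm g.
Proof.
apply: dual_norm_min => [|x]; first by rewrite mulr_ge0 ?dual_norm_ge0.
by rewrite [X in X <= _]normrZ -mulrA ler_wpM2l ?dual_norm_le.
Qed.

Let dual_normZ (a : R) (g : dual) : dual_norm (a *: g) = `|a| * dual_norm g.
Proof.
apply/eqP; rewrite eq_le dual_normZ_le/=.
have [->|a0] := eqVneq a 0; first by rewrite normr0 mul0r dual_norm_ge0.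
rewrite -ler_pdivlMl ?normr_gt0// -normfV.
by rewrite -[X in dual_norm X <= _](scalerK a0)// dual_normZ_le.
Qed.

Let dual_norm0_eq0 (g : dual) : dual_norm g = 0 -> g = 0.
Proof.
move=> g0; apply/val_inj/funext => x /=; apply/eqP.
by rewrite -normr_le0 (le_trans (dual_norm_le g x))// g0 mul0r.
Qed.

HB.instance Definition _ := @Lmodule_isNormed.Build R dual dual_norm
  dual_normD dual_normZ dual_norm0_eq0.

Lemma dual_normE (g : dual) :
  `|g| = sup [set g x / `|x| | x in [set x : X | x != 0]].
Proof. by []. Qed.

End Dual.
Arguments bounded_functional {R} X.

Section Reflexive.
Context {R : realType} (X : normedModType R).

Definition eval_at (x : X) : dual X -> R^o := fun g => g x.

Lemma eval_at_bounded (x : X) : eval_at x \in bounded_functional (dual X).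
Proof.
apply/bounded_functionalP; split=> [//|].
have lin : linear (eval_at x) by [].
pose L := GRing.isLinear.Build R (dual X) R^o _ (eval_at x) lin.
pose F : {linear dual X -> R^o} := HB.pack (eval_at x) L.
apply: (@bounded_linear_continuous _ _ _ F); apply/linear_boundedP.
exists `|x|; split=> [|r xr g]; first exact: normr_real.
apply: (le_trans (dual_norm_le g x)).
by rewrite [X in X <= _]mulrC ler_wpM2r ?dual_norm_ge0// ltW.
Qed.

Definition canonical_embedding (x : X) : dual (dual X) :=
  Dual (eval_at_bounded x).

Definition reflexive_space : Prop :=
  forall F : dual (dual X), exists x : X, canonical_embedding x = F.

Definition strictly_convex : Prop :=
  forall (y1 y2 : X) (t : R), y1 != y2 -> `|y1| = 1 -> `|y2| = 1 ->
    0 < t < 1 -> `|t *: y1 + (1 - t) *: y2| < 1.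

End Reflexive.

Section Adjoint.
Context {R : realType} {X Y : normedModType R} (T : {linear X -> Y})
  (T_continuous : continuous T).

Lemma adjoint_bounded (g : dual Y) : (g \o T) \in bounded_functional X.
Proof.
apply/bounded_functionalP; split=> [a x y|x]; first by rewrite /= !linearP.
by apply: continuous_comp; [exact: T_continuous | exact: dual_continuous].
Qed.

Definition adjoint (g : dual Y) : dual X := Dual (adjoint_bounded g).

End Adjoint.

Section Duality.
Context {R : realType} (Y : normedModType R).

Definition duality_set (y : Y) : set (dual Y) :=
  [set g : dual Y | g y = `|y| ^+ 2 /\ `|y| ^+ 2 = `|g| ^+ 2].

(* The unique element of [duality_set y] when Y and its dual are strictly
   convex and reflexive; 0 if the set is empty. *)
Definition duality_map (y : Y) : dual Y := xget 0 (duality_set y).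

(* The two-sided inverse of [duality_map] whenever the latter is bijective. *)
Definition duality_map_inv : dual Y -> Y :=
  'pinv_(fun=> 0) [set: Y] duality_map.

End Duality.
Arguments duality_map {R Y} y.
Arguments duality_map_inv {R Y} g.

Section Subspace.
Context {R : realType} {X : normedModType R} (S : submodClosed X).

(* The linear subspace S as a normed space with the norm of X. *)
Record subsp := Subsp { subsp_val : X; subsp_valP : subsp_val \in S }.

HB.instance Definition _ := [isSub for subsp_val].
HB.instance Definition _ := [Choice of subsp by <:].
HB.instance Definition _ := [SubChoice_isSubLmodule of subsp by <:].

Let subsp_norm (x : subsp) : R := `|\val x|.

Let subsp_normD (x y : subsp) : subsp_norm (x + y) <= subsp_norm x + subsp_norm y.
Proof. exact: ler_normD. Qed.

Let subsp_normZ (a : R) (x : subsp) : subsp_norm (a *: x) = `|a| * subsp_norm x.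
Proof. exact: normrZ. Qed.

Let subsp_norm0_eq0 (x : subsp) : subsp_norm x = 0 -> x = 0.
Proof. by move=> /normr0_eq0 x0; exact: val_inj. Qed.

HB.instance Definition _ := @Lmodule_isNormed.Build R subsp subsp_norm
  subsp_normD subsp_normZ subsp_norm0_eq0.

Lemma subsp_normE (x : subsp) : `|x| = `|\val x|. Proof. by []. Qed.

Definition injection : {linear subsp -> X} := \val.

Lemma injection_continuous : continuous injection.
Proof.
apply: bounded_linear_continuous; apply/linear_boundedP.
by exists 1; split=> [|r r1 x]; [exact: real1 | rewrite ler_peMl// ltW].
Qed.

Definition restriction : dual X -> dual subsp := adjoint injection_continuous.

End Subspace.
Arguments injection {R X} S.
Arguments restriction {R X} S g.

Definition finite_dimensional {R : realType} (X : lmodType R) : Prop :=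
  exists (n : nat) (e : 'I_n -> X), forall x, exists c : 'I_n -> R,
    x = \sum_(i < n) c i *: e i.

Definition saddle_point {R : realType} {X Y : Type} (L : X -> Y -> R)
    (x0 : X) (y0 : Y) : Prop :=
  forall x y, L x0 y <= L x0 y0 /\ L x0 y0 <= L x y0.

(* A saddle point (rm, un) of this functional over Vm x Un is what "un is the
   Lagrange multiplier and rm the minimizer" means for the minimization of
   1/2 |v|^2 - <f, v> over v in Vm subject to <B w, v> = 0 for all w in Un. *)
Definition lagrangian {R : realType} {U V : normedModType R}
    (B : U -> dual V) (f : dual V) (v : V) (w : U) : R :=
  2^-1 * `|v| ^+ 2 - f v + B w v.

(* Main.v *)
(* The duality map of V_m is the restriction of the one of V: an extension with
   equal norm of an element of J_{V_m}(x) lies in J_V(x), which is a singleton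
   since V^* is strictly convex.  As V_m is reflexive, r = J_{V_m}^{-1}(g) means
   exactly that g belongs to the duality set of r, so the first equation of (i)
   reads r_m = J_{V_m}^{-1}(I_m^*(f - B u_n)), and (i) <-> (ii).
   (ii) -> (iii) tests competing residuals against r_m.  For (iii) -> (ii), at a
   residual g of least norm in g + W, Hahn-Banach yields a functional on
   (V_m)^* that norms g and kills W; by reflexivity it is the evaluation at an x
   with g in J(x), whence x = r_m.  Completing the square turns (i) into the
   saddle point (iv); conversely, testing the minimality of r_m against
   x = J_{V_m}^{-1}(I_m^*(f - B u_n)) gives (|x| - |r_m|)^2 <= 0. *)
Require Import Defs.
From HB Require Import structures.
From mathcomp Require Import all_boot all_order all_algebra.
From mathcomp Require Import boolp classical_sets functions reals topology.
From mathcomp Require Import normedtype.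
From mathcomp Require Import ring lra.

Import Order.TTheory GRing.Theory Num.Theory.
Import numFieldNormedType.Exports.

Local Open Scope classical_set_scope.
Local Open Scope ring_scope.

(** * Hahn-Banach extension under cone constraints, by minimal sublinear functionals *)

Section HahnBanach.
Context {R : realType} {X : lmodType R}.
Implicit Types p q : X -> R.

Definition sublinear p := (forall x y, p (x + y) <= p x + p y) /\
  (forall (t : R) x, 0 <= t -> p (t *: x) <= t * p x).

Lemma sublinear0 p : sublinear p -> p 0 = 0.
Proof.
move=> [pD pZ]; apply/eqP; rewrite eq_le; apply/andP; split.
  by have := pZ 0 0 (lexx _); rewrite scale0r mul0r.
by have := pD 0 0; rewrite addr0 lerDl.
Qed.

Lemma sublinearN p x : sublinear p -> - p (- x) <= p x.
Proof.
by move=> sp; have := sp.1 x (- x); rewrite subrr sublinear0//; lra.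
Qed.

Lemma sublinearZ p t x : sublinear p -> 0 <= t -> p (t *: x) = t * p x.
Proof.
move=> sp; rewrite le_eqVlt => /predU1P[<-|t0].
  by rewrite scale0r mul0r sublinear0.
apply/eqP; rewrite eq_le (sp.2 _ _ (ltW t0))/=.
have := sp.2 t^-1 (t *: x); rewrite invr_ge0 ltW// => /(_ isT).
by rewrite scalerA mulVf ?gt_eqF// scale1r ler_pdivlMl.
Qed.

Definition minimal_sublinear q := forall q', sublinear q' ->
  (forall x, q' x <= q x) -> forall x, q x <= q' x.

(** Zorn's lemma: a chain is bounded by its pointwise infimum, finite because every sublinear [q]
    below [p] satisfies [q x >= - p (- x)]. *)
Lemma sublinear_minorant p : sublinear p ->
  exists q, [/\ sublinear q, forall x, q x <= p x & minimal_sublinear q].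
Proof.
move=> sp; pose T := {q | sublinear q /\ forall x, q x <= p x}.
(* The order is reversed, so that Zorn's maximal element is pointwise minimal. *)
pose ge (q q' : T) := `[< forall x, sval q' x <= sval q x >].
pose inT q sq qp : T := exist _ q (conj sq qp).
have refl u : ge u u by apply/asboolP.
have p0 : T by exact: (inT p sp (fun x => lexx (p x))).
have [//|||[q [sq qp]] qmin] := @ZL_preorder T p0 ge.
- move=> r s t /asboolP rs /asboolP st; apply/asboolP => x.
  exact: le_trans (st x) (rs x).
- move=> A Atot.
  have [->|/set0P A0] := eqVneq A set0; first by exists p0.
  pose E x := [set sval u x | u in A].
  have lbE x : has_lbound (E x).
    exists (- p (- x)) => _ [[q [sq qp]] _ <-] /=.
    by rewrite (le_trans _ (sublinearN q x sq))// lerN2.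
  have E0 x : E x !=set0 by case: A0 => q Aq; exists (sval q x), q.
  have infE u x : A u -> inf (E x) <= sval u x.
    by move=> Au; apply: (ge_inf (lbE x)); exists u.
  suff si : sublinear (fun x => inf (E x)).
    have ip x : inf (E x) <= p x.
      by case: A0 => q Aq; rewrite (le_trans (infE q x Aq))//; case: (svalP q).
    by exists (inT _ si ip) => q Aq; apply/asboolP => x; exact: infE.
  split=> [x y|t x t0].
  + rewrite -lerBlDr; apply: lb_le_inf => // _ [q Aq <-].
    rewrite lerBlDr -lerBlDl; apply: lb_le_inf => // _ [r Ar <-].
    rewrite lerBlDl.
    (* Comparability makes the infimum subadditive: the smaller of [q] and [r] serves at both
       points. *)
    have [/asboolP qr|/asboolP rq] := Atot q r Aq Ar.
      rewrite (le_trans (infE r _ Ar))// (le_trans ((svalP r).1.1 _ _))//.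
      by rewrite lerD2r.
    rewrite (le_trans (infE q _ Aq))// (le_trans ((svalP q).1.1 _ _))//.
    by rewrite lerD2l.
  + move: t0; rewrite le_eqVlt => /predU1P[<-|t0].
      case: A0 => q Aq; rewrite mul0r scale0r (le_trans (infE q _ Aq))//.
      by rewrite sublinear0//; case: (svalP q) => -[].
    rewrite -ler_pdivrMl//; apply: lb_le_inf => // _ [q Aq <-].
    rewrite ler_pdivrMl// (le_trans (infE q _ Aq))//.
    by case: (svalP q) => -[_ +] _; apply; exact: ltW.
exists q; split=> // q' sq' q'q.
have q'p x : q' x <= p x by exact: le_trans (q'q x) (qp x).
by have /asboolP := qmin (inT _ sq' q'p) (introT (asboolP _) q'q).
Qed.

(** A pair [(a, c)] stands for the constraint [0 <= g a + c] on an unknown functional [g]. *)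
Definition cone (C : X -> R -> Prop) := [/\ C 0 0,
  forall a b c d, C a c -> C b d -> C (a + b) (c + d) &
  forall t a c, 0 <= t -> C a c -> C (t *: a) (t * c)].

(* The infimal convolution [inf {p (x + a) + c | C a c}]. *)
Lemma sublinear_cone p (C : X -> R -> Prop) : sublinear p -> cone C ->
  (forall a c, C a c -> 0 <= p a + c) ->
  exists q, [/\ sublinear q, forall x, q x <= p x &
                forall a c, C a c -> q (- a) <= c].
Proof.
move=> sp [C0 CD CZ] pC.
pose E x := [set p (x + u.1) + u.2 | u in [set u | C u.1 u.2]].
have lbE x : has_lbound (E x).
  exists (- p (- x)) => _ [[a c] /= Cac <-].
  have := sp.1 (x + a) (- x); rewrite addrAC subrr add0r.
  by have := pC _ _ Cac; lra.
have E0 x : E x !=set0 by exists (p (x + 0) + 0), (0, 0).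
have infE x a c : C a c -> inf (E x) <= p (x + a) + c.
  by move=> Cac; apply: (ge_inf (lbE x)); exists (a, c).
exists (fun x => inf (E x)); split=> [|x|a c Cac].
- split=> [x y|t x].
  + rewrite -lerBlDr; apply: lb_le_inf => // _ [[a c] /= Cac <-].
    rewrite lerBlDr -lerBlDl; apply: lb_le_inf => // _ [[b d] /= Cbd <-].
    rewrite lerBlDl (le_trans (infE _ _ _ (CD _ _ _ _ Cac Cbd)))//.
    by have := sp.1 (x + a) (y + b); rewrite addrACA; lra.
  + rewrite le_eqVlt => /predU1P[<-|t0].
      by rewrite mul0r scale0r (le_trans (infE _ _ _ C0))// !addr0 sublinear0.
    rewrite -ler_pdivrMl//; apply: lb_le_inf => // _ [[a c] /= Cac <-].
    rewrite ler_pdivrMl// (le_trans (infE _ _ _ (CZ _ _ _ (ltW t0) Cac)))//.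
    by rewrite -scalerDr (sublinearZ _ _ _ sp (ltW t0)) -mulrDr.
- by have := infE x _ _ C0; rewrite !addr0.
- by rewrite (le_trans (infE _ _ _ Cac))// addNr sublinear0// add0r.
Qed.

(* Otherwise the infimal convolution with the ray through [(y, - q y)] would be
   a strictly smaller sublinear functional. *)
Lemma minimal_sublinear_linear q : sublinear q -> minimal_sublinear q ->
  linear (q : X -> R^o).
Proof.
move=> sq qmin.
have qD x y : q (x + y) = q x + q y.
  apply/eqP; rewrite eq_le sq.1/=.
  pose C a c := exists2 t, 0 <= t & a = t *: y /\ c = - (t * q y).
  have [|a c [t t0 [-> ->]]|r [sr rq rC]] := sublinear_cone q C sq.
  - split=> [|_ _ _ _ [s s0 [-> ->]] [t t0 [-> ->]]|t _ _ t0 [s s0 [-> ->]]].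
    + by exists 0; rewrite // scale0r mul0r oppr0.
    + by exists (s + t); rewrite ?addr_ge0// scalerDl mulrDl opprD.
    + by exists (t * s); rewrite ?mulr_ge0// scalerA mulrN mulrA.
  - by rewrite sublinearZ// subrr.
  (* Minimality gives [q x <= r x <= r (x + y) + r (- y) <= q (x + y) - q y]. *)
  have /rC : C y (- q y) by exists 1; rewrite // scale1r mul1r.
  have := sr.1 (x + y) (- y); rewrite addrK => h1 h2.
  by have := qmin r sr rq x; have := rq (x + y); lra.
have qN x : q (- x) = - q x.
  by have := qD x (- x); rewrite subrr sublinear0//; lra.
move=> t x y; rewrite qD; congr (_ + _).
have [t0|t0] := leP 0 t; first exact: sublinearZ.
rewrite -[t]opprK scaleNr qN sublinearZ ?oppr_ge0 ?(ltW t0)//.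
by rewrite -[RHS]/(- - t * q x) mulNr.
Qed.

(* With [C] the graph of [- g] on a subspace (elements [- s] paired with [g s])
   this is the extension theorem; with [C] spanned by [(y, - p y)] it gives a
   functional dominated by [p] and agreeing with it at [y]. *)
Theorem hahn_banach_cone p (C : X -> R -> Prop) : sublinear p -> cone C ->
  (forall a c, C a c -> 0 <= p a + c) ->
  exists g : X -> R^o, [/\ linear g, forall x, g x <= p x &
    forall a c, C a c -> 0 <= g a + c].
Proof.
move=> sp cC pC; have [q [sq qp qC]] := sublinear_cone p C sp cC pC.
have [g [sg gq gmin]] := sublinear_minorant q sq.
exists g; split=> [|x|a c Cac]; first exact: minimal_sublinear_linear.
  exact: le_trans (gq x) (qp x).
have := sublinearN g (- a) sg; rewrite opprK.
by have := gq (- a); have := qC _ _ Cac; lra.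
Qed.

End HahnBanach.

(** * Duality sets and norm-preserving extension *)

Section DualSpace.
Context {R : realType}.

Lemma dual_of_bounded_linear (X : normedModType R) (g : X -> R^o) (M : R) :
  0 <= M -> linear g -> (forall x, g x <= M * `|x|) ->
  exists2 h : dual X, `|h| <= M & h =1 g.
Proof.
move=> M0 gl gM.
pose L : {linear X -> R^o} := HB.pack g (GRing.isLinear.Build R X R^o _ g gl).
have gM' x : `|L x| <= M * `|x|.
  by rewrite ler_norml gM andbT lerNl -linearN -[in leRHS]normrN gM.
have gb : g \in bounded_functional X.
  apply/bounded_functionalP; split=> //.
  apply: (@bounded_linear_continuous _ _ _ L); apply/linear_boundedP.
  near=> r => x; rewrite (le_trans (gM' x))// ler_wpM2r//.
  by near: r; apply: nbhs_pinfty_ge; exact: num_real.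
by exists (Dual gb) => //; exact: dual_norm_min.
Unshelve. all: by end_near. Qed.

Theorem hahn_banach_dual (X : normedModType R) (M : R) (C : X -> R -> Prop) :
  0 <= M -> cone C -> (forall a c, C a c -> 0 <= M * `|a| + c) ->
  exists2 g : dual X, `|g| <= M & forall a c, C a c -> 0 <= g a + c.
Proof.
move=> M0 cC MC.
have [|g [gl gM gC]] := hahn_banach_cone (fun x => M * `|x|) C _ cC MC.
  split=> [x y|t x t0]; first by rewrite -mulrDr ler_wpM2l// ler_normD.
  by rewrite normrZ ger0_norm// mulrCA.
have [h hM hg] := dual_of_bounded_linear X g M M0 gl gM.
by exists h => // a c; rewrite hg; exact: gC.
Qed.

Lemma dual_le (X : normedModType R) (g : dual X) x : g x <= `|g| * `|x|.
Proof. exact: le_trans (ler_norm _) (dual_norm_le g x). Qed.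

(** Since [g x <= |g| * |x|], the two inequalities force equality throughout. *)
Lemma duality_setP (X : normedModType R) (x : X) (g : dual X) :
  `|g| <= `|x| -> `|x| ^+ 2 <= g x -> duality_set x g.
Proof.
move=> gx xg; have := dual_le X g x => gle.
have x0 := normr_ge0 x; have g0 := normr_ge0 g.
have e : `|g| * `|x| <= `|x| * `|x| by rewrite ler_wpM2r.
have {}xg : g x = `|x| ^+ 2.
  by apply/eqP; rewrite eq_le xg andbT (le_trans gle).
split=> //; congr (_ ^+ 2); apply/eqP; rewrite eq_le gx andbT.
have [->//|xn0] := eqVneq x 0; first by rewrite normr0.
by rewrite -(@ler_pM2r _ `|x|) ?normr_gt0// -expr2 -xg.
Qed.

Lemma duality_set_norm (X : normedModType R) (x : X) (g : dual X) :
  duality_set x g -> `|g| = `|x|.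
Proof.
by move=> [_ /eqP]; rewrite eqrXn2// => /eqP.
Qed.

(** The ray through [(x, - |x| ^+ 2)] imposes [|x| ^+ 2 <= g x] under the bound [|g| <= |x|]. *)
Lemma duality_set_nonempty (X : normedModType R) (x : X) :
  exists g : dual X, duality_set x g.
Proof.
pose C (a : X) (c : R) :=
  exists2 t, 0 <= t & a = t *: x /\ c = - (t * `|x| ^+ 2).
have [//||a c [t t0 [-> ->]]|g gx gC] := hahn_banach_dual X `|x| C.
- split=> [|_ _ _ _ [s s0 [-> ->]] [t t0 [-> ->]]|t _ _ t0 [s s0 [-> ->]]].
  + by exists 0; rewrite // scale0r mul0r oppr0.
  + by exists (s + t); rewrite ?addr_ge0// scalerDl mulrDl opprD.
  + by exists (t * s); rewrite ?mulr_ge0// scalerA mulrN mulrA.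
- by rewrite normrZ ger0_norm// expr2 mulrCA subrr.
exists g; apply: duality_setP => //.
have : 0 <= g x - `|x| ^+ 2 by apply: gC; exists 1; rewrite // scale1r mul1r.
by rewrite subr_ge0.
Qed.

(** The pairs [(- s, g s)] impose [h s <= g s] on [S]; replacing [s] by [- s] gives equality. *)
Lemma dual_extension (X : normedModType R) (S : submodClosed X)
    (g : dual (subsp S)) :
  exists2 h : dual X, `|h| <= `|g| & restriction S h = g.
Proof.
pose C (a : X) (c : R) := exists s : subsp S, a = - \val s /\ c = g s.
have [//||a c [s [-> ->]]|h hg hC] := hahn_banach_dual X `|g| C.
- split=> [|_ _ _ _ [s [-> ->]] [t [-> ->]]|t _ _ t0 [s [-> ->]]].
  + by exists 0; rewrite !linear0.
  + by exists (s + t); rewrite !linearD.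
  + by exists (t *: s); rewrite !linearZ.
- have := dual_le _ g (- s); rewrite linearN !normrN subsp_normE.
  by rewrite -lerBlDr sub0r.
exists h => //; apply/val_inj/funext => /= s.
have le (u : subsp S) : h (\val u) <= g u.
  have /hC : C (- \val u) (g u) by exists u.
  by rewrite linearN addrC subr_ge0.
apply/eqP; rewrite eq_le le/=.
by have := le (- s); rewrite !linearN lerN2.
Qed.

(** * Strict convexity: uniqueness on either side of the duality relation *)

Lemma strictly_convex_ltD (X : normedModType R) (x y : X) :
  strictly_convex X -> x != y -> `|x| = `|y| -> `|x + y| < `|x| + `|y|.
Proof.
move=> cX xy exy; have [x0|x0] := eqVneq x 0.
  by move: xy; rewrite x0 in exy *; rewrite eq_sym -normr_eq0 -exy normr0 eqxx.
have r0 : 0 < `|x| by rewrite normr_gt0.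
have rV : `| `|x|^-1 | = `|x|^-1 by rewrite ger0_norm// invr_ge0.
have := cX (`|x|^-1 *: x) (`|x|^-1 *: y) 2^-1.
rewrite !normrZ -exy rV mulVf ?gt_eqF//.
have h2 : 0 < (2^-1 : R) < 1 by apply/andP; split; lra.
move=> /(_ _ erefl erefl h2); rewrite (_ : 1 - 2^-1 = 2^-1 :> R); last by lra.
rewrite -!scalerDr !normrZ rV ger0_norm ?invr_ge0// => H.
have {H} : 2^-1 * (`|x|^-1 * `|x + y|) < 1.
  apply: H; apply: contra xy => /eqP /(scalerI _) -> //.
  by rewrite invr_eq0 gt_eqF.
by rewrite mulrCA ltr_pdivrMl// mulr1; lra.
Qed.

(** Two distinct elements would have [|g + h| < 2 |x|], contradicting [(g + h) x = 2 |x| ^+ 2]. *)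
Lemma duality_set_subset1 (X : normedModType R) (x : X) (g h : dual X) :
  strictly_convex (dual X) -> duality_set x g -> duality_set x h -> g = h.
Proof.
move=> cX xg xh; apply/eqP/negPn/negP => gh.
have ng := duality_set_norm _ _ _ xg; have nh := duality_set_norm _ _ _ xh.
have := strictly_convex_ltD _ _ _ cX gh; rewrite ng nh => /(_ erefl) lt.
have [x0|x0] := eqVneq x 0.
  by move: lt; rewrite x0 normr0 addr0 normr_lt0.
have := dual_le _ (g + h) x; rewrite -[(g + h) x]/(g x + h x) xg.1 xh.1.
by rewrite !expr2 -mulrDl ler_pM2r ?normr_gt0// leNgt lt.
Qed.

Lemma duality_set_inj (X : normedModType R) (x y : X) (g : dual X) :
  strictly_convex X -> duality_set x g -> duality_set y g -> x = y.
Proof.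
move=> cX xg yg; apply/eqP/negPn/negP => xy.
have nx := duality_set_norm _ _ _ xg; have ny := duality_set_norm _ _ _ yg.
have := strictly_convex_ltD _ _ _ cX xy; rewrite -nx -ny => /(_ erefl) lt.
have [g0|g0] := eqVneq g 0.
  by move: lt; rewrite g0 normr0 addr0 normr_lt0.
have := dual_le _ g (x + y); rewrite (linearD g x y : _ = g x + g y).
rewrite xg.1 yg.1 -nx -ny.
by rewrite !expr2 -mulrDr ler_pM2l ?normr_gt0// leNgt lt.
Qed.

(** * Reflexivity in finite dimension, surjectivity and least residuals *)

Lemma scale_linear (W : lmodType R) (phi : W -> R^o) : linear phi ->
  forall t w, phi (t *: w) = t * phi w.
Proof.
move=> phil t w.
pose L : {linear W -> R^o} :=
  HB.pack phi (GRing.isLinear.Build R W R^o _ phi phil).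
exact: (linearZ_LR L).
Qed.

(** Induction on [n]: if [phi ord0] vanishes on the common kernel of the others it is dropped;
    otherwise a vector [a] dual to it isolates its coefficient [F a]. *)
Lemma linear_ker_span (W : lmodType R) (n : nat) (phi : 'I_n -> W -> R^o)
    (F : W -> R^o) : (forall i, linear (phi i)) -> linear F ->
  (forall w, (forall i, phi i w = 0) -> F w = 0) ->
  exists c : 'I_n -> R, forall w, F w = \sum_i c i * phi i w.
Proof.
elim: n phi F => [|n IH] phi F phil Fl kerF.
  by exists (fun=> 0) => w; rewrite big_ord0 kerF// => -[].
have [[a [a0 a1]]|noa] := pselect (exists a,
    (forall i, phi (lift ord0 i) a = 0) /\ phi ord0 a = 1); last first.
  have kerF' w : (forall i, phi (lift ord0 i) w = 0) -> F w = 0.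
    move=> w0; apply: kerF => i; have [j ->//|->] := unliftP ord0 i.
    have [//|nz] := eqVneq (phi ord0 w) 0; case: noa.
    exists ((phi ord0 w)^-1 *: w); split=> [j|].
      by rewrite (scale_linear _ _ (phil _)) w0 mulr0.
    by rewrite (scale_linear _ _ (phil _)) mulVf.
  have [c Fc] := IH _ F (fun i => phil _) Fl kerF'.
  exists (fun i => if unlift ord0 i is Some j then c j else 0) => w.
  rewrite big_ord_recl unlift_none mul0r add0r Fc.
  by apply: eq_bigr => i _; rewrite liftK.
pose G w := F w - F a * phi ord0 w.
have Gl : linear (G : W -> R^o).
  move=> t x y; rewrite /G Fl phil.
  rewrite -[RHS]/(t * (F x - F a * phi ord0 x) + (F y - F a * phi ord0 y)).
  rewrite -[t *: F x]/(t * F x) -[t *: phi ord0 x]/(t * phi ord0 x).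
  ring.
have kerG w : (forall i, phi (lift ord0 i) w = 0) -> G w = 0.
  (* Subtracting [phi ord0 w *: a] moves [w] into every kernel. *)
  move=> w0; have : F (- phi ord0 w *: a + w) = 0.
    apply: kerF => i; rewrite phil; have [j ->|->] := unliftP ord0 i.
      by rewrite a0 w0 scaler0 addr0.
    rewrite a1 -[_ *: 1]/(- phi ord0 w * 1); ring.
  rewrite Fl -[_ *: F a]/(- phi ord0 w * F a) /G => <-; ring.
have [c Gc] := IH _ G (fun i => phil _) Gl kerG.
exists (fun i => if unlift ord0 i is Some j then c j else F a) => w.
rewrite big_ord_recl unlift_none; apply: (addIr (- (F a * phi ord0 w))).
rewrite addrAC subrr add0r -[LHS]/(G w) Gc.
by apply: eq_bigr => i _; rewrite liftK.
Qed.


Lemma norm_canonical_embedding (X : normedModType R) (x : X) :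
  `|canonical_embedding x| = `|x|.
Proof.
apply/eqP; rewrite eq_le; apply/andP; split.
  apply: dual_norm_min => // g; rewrite [leRHS]mulrC; exact: (dual_norm_le g x).
have [g xg] := duality_set_nonempty X x.
have [->|x0] := eqVneq x 0; first by rewrite normr0.
have := dual_le _ (canonical_embedding x) g.
rewrite -[canonical_embedding x g]/(g x) xg.1 (duality_set_norm _ _ _ xg) expr2.
by rewrite ler_pM2r ?normr_gt0.
Qed.

Lemma duality_set_sym (X : normedModType R) (x : X) (g : dual X) :
  duality_set g (canonical_embedding x) -> duality_set x g.
Proof.
move=> [gx /eqP]; rewrite norm_canonical_embedding eqrXn2// => /eqP gxn.
by rewrite /duality_set /= -gxn.
Qed.

(** A functional killing every [e i] is zero, so [F] is a combination of the evaluations at the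
    [e i]. *)
Lemma finite_dimensional_reflexive (X : normedModType R) :
  finite_dimensional X -> reflexive_space X.
Proof.
move=> [n [e span]] F.
have [||g ge|c Fc] := linear_ker_span (dual X) n (fun i g => g (e i)) F.
- by [].
- exact: dual_linear.
- suff -> : g = 0 by rewrite linear0.
  apply/val_inj/funext => x /=; have [c ->] := span x.
  by rewrite linear_sum big1// => i _; rewrite linearZ_LR/= ge scaler0.
exists (\sum_i c i *: e i); apply/val_inj/funext => g.
rewrite -[LHS]/(g (\sum_i c i *: e i)) -[RHS]/(F g) Fc linear_sum.
by apply: eq_bigr => i _; rewrite linearZ_LR.
Qed.

(** A functional norming [g] is, by reflexivity, the evaluation at the wanted point. *)
Lemma duality_set_surj (X : normedModType R) (g : dual X) :
  reflexive_space X -> exists x : X, duality_set x g.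
Proof.
move=> rX; have [F gF] := duality_set_nonempty _ g; have [x xF] := rX F.
by exists x; apply: duality_set_sym; rewrite xF.
Qed.

(** First-order optimality of [|g - T w|] at [w = 0], obtained by separation rather than by
    differentiating the norm. *)
Lemma minimal_residual (X : normedModType R) (Y : lmodType R)
    (T : Y -> dual X) (g : dual X) : reflexive_space X -> linear T ->
  (forall w, `|g| <= `|g - T w|) ->
  exists2 x : X, duality_set x g & forall w, T w x = 0.
Proof.
move=> rX Tl gmin.
pose L : {linear Y -> dual X} :=
  HB.pack T (GRing.isLinear.Build R Y (dual X) _ T Tl).
rewrite -[T]/(L : _ -> _) in gmin *.
(* The pair with [t = 1] and [w = 0] forces [F g >= |g| ^+ 2]; those with [t = 0] force
   [F (L w) <= 0]. *)
pose C (h : dual X) (c : R) := exists t w,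
  [/\ 0 <= t, h = t *: g - L w & c = - (t * `|g| ^+ 2)].
have [//||_ _ [t [w [t0 -> ->]]]|F Fg FC] := hahn_banach_dual (dual X) `|g| C.
- split=> [|_ _ _ _ [s [v [s0 -> ->]]] [t [w [t0 -> ->]]]|
          t _ _ t0 [s [w [s0 -> ->]]]].
  + by exists 0, 0; rewrite linear0 scale0r mul0r subr0 oppr0.
  + exists (s + t), (v + w); rewrite addr_ge0// scalerDl mulrDl opprD linearD.
    by rewrite opprD addrACA.
  + exists (t * s), (t *: w).
    by rewrite mulr_ge0// scalerBr scalerA (linearZ_LR L) mulrN mulrA.
- rewrite subr_ge0 expr2 mulrCA ler_wpM2l//.
  move: t0; rewrite le_eqVlt => /predU1P[<-|t0]; first by rewrite mul0r.
  (* Rescaling [w] by [t^-1] reduces the bound to the minimality of [g]. *)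
  have -> : t *: g - L w = t *: (g - L (t^-1 *: w)).
    by rewrite scalerBr -(linearZ_LR L) scalerA mulfV ?gt_eqF// scale1r.
  by rewrite normrZ gtr0_norm// ler_pM2l.
have [x xF] := rX F.
have gF : duality_set g F.
  apply: duality_setP => //; have /FC : C g (- `|g| ^+ 2).
    by exists 1, 0; rewrite linear0 scale1r mul1r subr0.
  by rewrite subr_ge0.
exists x; first by apply: duality_set_sym; rewrite xF.
have le w : L w x <= 0.
  have /FC : C (- L w) 0 by exists 0, w; rewrite scale0r add0r mul0r oppr0.
  by rewrite addr0 -xF -[canonical_embedding x _]/(- L w x) oppr_ge0.
move=> w; apply/eqP; rewrite eq_le le/=.
by have := le (- w); rewrite (linearN L) -[(- L w) x]/(- L w x) oppr_le0.
Qed.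

(** * The duality map on subspaces and its inverse *)

Lemma duality_mapP (X : normedModType R) (x : X) :
  duality_set x (duality_map x).
Proof. exact: xgetPex _ (duality_set_nonempty X x). Qed.

Lemma strictly_convex_subsp (X : normedModType R) (S : submodClosed X) :
  strictly_convex X -> strictly_convex (subsp S).
Proof.
move=> cX y z t yz; rewrite !subsp_normE => ny nz t01.
by rewrite linearD !linearZ; apply: cX => //; rewrite val_eqE.
Qed.

Lemma duality_set_subsp (X : normedModType R) (S : submodClosed X)
    (x : subsp S) (g : dual (subsp S)) : strictly_convex (dual X) ->
  duality_set x g <-> restriction S (duality_map (\val x)) = g.
Proof.
move=> cX; have xd := duality_mapP X (\val x); split=> [xg|<-].
  have [h hg rhg] := dual_extension _ _ g; rewrite -rhg; congr restriction.
  apply: (duality_set_subset1 X (\val x)) => //; apply: duality_setP.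
    by rewrite (le_trans hg)// (duality_set_norm _ _ _ xg).
  by rewrite -[h (\val x)]/(restriction S h x) rhg xg.1.
(* Restriction keeps the value at [x] and does not increase the norm. *)
apply: duality_setP; last first.
  by rewrite -[leRHS]/(duality_map (\val x) (\val x)) xd.1.
apply: dual_norm_min => // v.
rewrite -[restriction _ _ v]/(duality_map (\val x) (\val v)).
rewrite (le_trans (dual_norm_le _ _))//.
by rewrite -[dual_norm _]/`|duality_map (\val x)| (duality_set_norm _ _ _ xd).
Qed.

(** Strict convexity gives injectivity, reflexivity surjectivity. Uniqueness is assumed directly,
    since on [Vm] it comes from strict convexity of the dual of [V]. *)
Lemma duality_map_invP (X : normedModType R) (x : X) (g : dual X) :
  reflexive_space X -> strictly_convex X ->
  (forall y : X, is_subset1 (duality_set y)) ->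
  x = duality_map_inv g <-> duality_set x g.
Proof.
move=> rX cX uX.
have JE (y : X) h : duality_set y h -> duality_map_inv h = y.
  move=> yh; rewrite (uX _ _ _ yh (duality_mapP X y)).
  apply: pinvKV; rewrite ?inE// => u v _ _ uv; apply: (duality_set_inj X).
  - exact: cX.
  - exact: duality_mapP.
  - by rewrite uv; exact: duality_mapP.
split=> [->|/JE//]; have [y yg] := duality_set_surj X g rX.
by rewrite (JE _ _ yg).
Qed.

End DualSpace.

(** * The cycle of implications between the four formulations *)

Theorem theorem4 (R : realType) (U V : completeNormedModType R)
    (B : {linear U -> dual V})
    (B_continuous : continuous B)
    (B_bounded_below : exists2 gammaB : R, 0 < gammaB &
       forall w : U, gammaB * `|w| <= `|B w|)
    (V_reflexive : reflexive_space V)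
    (dualV_reflexive : reflexive_space (dual V))
    (V_strictly_convex : strictly_convex V)
    (dualV_strictly_convex : strictly_convex (dual V))
    (f : dual V)
    (Un : submodClosed U) (Un_fin_dim : finite_dimensional (subsp Un))
    (Vm : submodClosed V) (Vm_fin_dim : finite_dimensional (subsp Vm))
    (rm : subsp Vm) (un : subsp Un) :
  [<->
    (* (i) *)
    (forall vm : subsp Vm,
        duality_map (\val rm) (\val vm) + B (\val un) (\val vm) = f (\val vm)) /\
    (forall wn : subsp Un, B (\val wn) (\val rm) = 0);
    (* (ii) *)
    (forall nun : dual V, [set B (\val wn) | wn in [set: subsp Un]] nun ->
        nun (injection Vm (duality_map_inv (restriction Vm (f - B (\val un))))) = 0) /\
    rm = duality_map_inv (restriction Vm (f - B (\val un)));
    (* (iii) *)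
    (forall wn : subsp Un,
        `|restriction Vm (f - B (\val un))| <= `|restriction Vm (f - B (\val wn))|) /\
    rm = duality_map_inv (restriction Vm (f - B (\val un)));
    (* (iv) *)
    saddle_point
      (fun (vm : subsp Vm) (wn : subsp Un) => lagrangian B f (\val vm) (\val wn)) rm un].

Proof.
pose G := restriction Vm (f - B (\val un)).
have GE (v : subsp Vm) : G v = f (\val v) - B (\val un) (\val v) by [].
have rVm := finite_dimensional_reflexive _ Vm_fin_dim.
have uVm (y : subsp Vm) : is_subset1 (duality_set y).
  move=> g h /(duality_set_subsp _ _ _ _ dualV_strictly_convex) <-.
  by move=> /(duality_set_subsp _ _ _ _ dualV_strictly_convex).
have invP (r : subsp Vm) g : r = duality_map_inv g <-> duality_set r g.
  by apply: duality_map_invP => //; exact: strictly_convex_subsp.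
have mixedP : (forall vm : subsp Vm, duality_map (\val rm) (\val vm)
    + B (\val un) (\val vm) = f (\val vm)) <-> duality_set rm G.
  rewrite duality_set_subsp//; split=> [Jf|JG v].
    apply/val_inj/funext => v; rewrite -[RHS]/(G v) GE -Jf.
    by rewrite -[LHS]/(duality_map (\val rm) (\val v)) addrK.
  have := congr1 (fun g : dual (subsp Vm) => g v) JG; rewrite GE.
  rewrite -[X in X = _ -> _]/(duality_map (\val rm) (\val v)) => ->.
  by rewrite subrK.
have LE (v : subsp Vm) :
  lagrangian B f (\val v) (\val un) = 2^-1 * `|v| ^+ 2 - G v.
  by rewrite /lagrangian GE opprB addrA addrAC.
tfae.
- move=> [/mixedP/invP rG Bw]; split=> // _ [w _ <-].
  by rewrite -rG; exact: Bw.
- move=> [nu0 rG]; split=> // w; have rmG := (invP _ _).1 rG.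
  rewrite -/G in nu0 rG *.
  have B0 (w' : subsp Un) : B (\val w') (\val rm) = 0.
    by rewrite rG; apply: nu0; exists w'.
  rewrite (duality_set_norm _ _ _ rmG).
  have [->|r0] := eqVneq rm 0; first by rewrite normr0.
  (* Every competing residual takes the value [G rm = |rm| ^+ 2] at [rm], as all [B w] vanish
     there. *)
  rewrite -(@ler_pM2r _ `|rm|) ?normr_gt0//.
  rewrite (le_trans _ (dual_le _ _ _))//.
  rewrite -[leRHS]/(f (\val rm) - B (\val w) (\val rm)) B0 -(B0 un) -GE.
  by rewrite rmG.1 expr2.
- move=> [Gmin rG]; have rmG := (invP _ _).1 rG; rewrite -/G in Gmin rG.
  have Bw (w : subsp Un) : B (\val w) (\val rm) = 0.
    pose T (w : subsp Un) := restriction Vm (B (\val w)).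
    have [|||x xG Tx] := minimal_residual (subsp Vm) (subsp Un) T G.
    - exact: rVm.
    - move=> t x y; apply/val_inj/funext => v.
      by rewrite -[LHS]/(B (\val (t *: x + y)) (\val v)) !linearP.
    (* The competitors [un + u] show that [G] has least norm in [G] plus the range of [T]. *)
    - move=> u; rewrite (le_trans (Gmin (un + u)))//.
      suff -> : restriction Vm (f - B (\val (un + u))) = G - T u by [].
      rewrite (_ : B (\val (un + u)) = B (\val un) + B (\val u)).
        by rewrite opprD addrA; apply/val_inj/funext.
      by rewrite !linearD.
    by rewrite rG -(_ : x = duality_map_inv G) ?invP//; exact: Tx.
  move=> v w; split; first by rewrite /lagrangian !Bw.
  (* As [G v <= |rm| |v|], the Lagrangian at [v] exceeds that at [rm] by at least
     [(|rm| - |v|) ^+ 2 / 2]. *)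
  have := sqr_ge0 (`|rm| - `|v|); have := dual_le _ G v.
  rewrite (duality_set_norm _ _ _ rmG) LE LE rmG.1 sqrrB.
  by rewrite !subsp_normE; lra.
- move=> sp; apply/and_comm; split.
    (* A linear form bounded above vanishes: shift by [un], then change sign. *)
    have Bs (w : subsp Un) : B (\val w) (\val rm) <= B (\val un) (\val rm).
      by have [+ _] := sp rm w; rewrite /lagrangian lerD2l.
    have le (w : subsp Un) : B (\val w) (\val rm) <= 0.
      have := Bs (un + w); rewrite !linearD.
      by rewrite -[leLHS]/(B (\val un) (\val rm) + B (\val w) (\val rm)) gerDl.
    move=> w; apply/eqP; rewrite eq_le le/=.
    have := le (- w); rewrite !linearN.
    by rewrite -[leLHS]/(- B (\val w) (\val rm)) oppr_le0.
  apply/mixedP; have [x xG] := duality_set_surj _ G rVm.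
  have [_] := sp x un; rewrite !LE xG.1 => h1.
  have h2 := dual_le _ G rm; have nG := duality_set_norm _ _ _ xG.
  rewrite nG in h2.
  have /eqP : (`|x| - `|rm|) ^+ 2 = 0.
    apply/eqP; rewrite eq_le sqr_ge0 andbT sqrrB.
    by move: h1 h2; rewrite !subsp_normE; lra.
  (* With equal norms, [h1] becomes [|rm| ^+ 2 <= G rm]. *)
  rewrite sqrf_eq0 subr_eq0 => /eqP xr; apply: duality_setP; rewrite ?nG ?xr//.
  by move: h1; rewrite !subsp_normE in xr *; rewrite xr; lra.
Qed.
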